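(* Let $\mathbb{K}$ be a field of characteristic zero and let $A$ be a linear operator on a finite-dimensional vector space $V$ over $\mathbb{K}$ such that the characteristic polynomial of $A$ splits over $\mathbb{K}$. Then for every eigenvalue $\lambda$ of $A$, there exists a basis of $E_\lambda$ which is a disjoint union of cycles of generalized eigenvectors of $A$ corresponding to $\lambda$.
   Context: Let $T$ be the characteristic polynomial of $A$, with distinct roots $\lambda_1,\dots,\lambda_k\in\mathbb{K}$ of multiplicities $m_1,\dots,m_k$, and let $n=\sum_j m_j=\dim V$. The principal Lagrange resolvent $\widehat{T_i}\in\mathbb{K}[x]$ with respect to $\lambda_i$ is the unique polynomial of degree less than $n$ with $\widehat{T_i}(\lambda_i)=1$, $\widehat{T_i}^{(m)}(\lambda_i)=0$ for $1\le m<m_i$, and $\widehat{T_i}^{(m)}(\lambda_j)=0$ for all $j\ne i$, $0\le m<m_j$ (derivatives are formal, $g^{(0)}=g$). For $\lambda=\lambda_i$, $E_\lambda$ denotes the range of the operator $\widehat{T_i}(A)$. A vector $v\in V$ is a generalized eigenvector of $A$ corresponding to $\lambda$ if $(A-\lambda I)^m v=0$ for some positive integer $m$. If $p$ is the smallest positive integer with $(A-\lambda I)^p v=0$, the set $\{v,(A-\lambda I)v,\dots,(A-\lambda I)^{p-1}v\}$ is called the cycle of generalized eigenvectors of $A$ corresponding to $\lambda$ generated by $v$. *)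

(* Defs.v *)
From Stdlib Require Import ClassicalEpsilon.
From mathcomp Require Import all_boot all_algebra.

Set Implicit Arguments.
Unset Strict Implicit.
Unset Printing Implicit Defensive.

Import GRing.Theory passmx.
Local Open Scope ring_scope.

Definition splits (K : fieldType) (T : {poly K}) : Prop :=
  exists s : seq K, T = \prod_(x <- s) ('X - x%:P).

(* The degree of g is less than that of T, and mup mu T is the multiplicity of
   mu as a root of T. *)
Definition is_principal_resolvent (K : fieldType) (T : {poly K}) (lambda : K)
    (g : {poly K}) : Prop :=
  [/\ (size g < size T)%N,
      g.[lambda] = 1,
      forall m, (1 <= m < mup lambda T)%N -> g^`(m).[lambda] = 0
    & forall mu, root T mu -> mu != lambda ->
        forall m, (m < mup mu T)%N -> g^`(m).[mu] = 0].

(* Definite description; see principal_resolvent_exists_unique below. *)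
Definition principal_resolvent (K : fieldType) (T : {poly K}) (lambda : K) :
    {poly K} :=
  epsilon (inhabits 0) (is_principal_resolvent T lambda).

Section ResolventExistsUnique.
Variable K : fieldType.
Implicit Types (g p T : {poly K}) (lambda mu : K) (s : seq K).

Lemma derivn_root mu p n k : ('X - mu%:P) ^+ n %| p -> (k < n)%N ->
  p^`(k).[mu] = 0.
Proof.
elim: k n p => [|k IHk] [|n] p // /dvdpP[r ->] kn.
  by rewrite /= hornerM horner_exp hornerXsubC subrr expr0n mulr0.
rewrite derivSn (IHk n) //.
rewrite derivM deriv_exp derivXsubC mul1r /= -mulr_natl mulrA exprS mulrA.
by rewrite dvdp_addl ?dvdp_mulIr.
Qed.

Lemma derivn_MXsubC r mu n :
  (r * ('X - mu%:P) ^+ n)^`(n).[mu] = r.[mu] *+ n`!.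
Proof.
elim: n r => [|n IHn] r; first by rewrite expr0 mulr1 mulr1n.
rewrite derivSn derivM deriv_exp derivXsubC mul1r /= exprS mulrA.
rewrite mulrnAr -mulrnAl -mulrDl IHn hornerD hornerM hornerXsubC hornerMn.
by rewrite subrr mulr0 add0r -mulrnA factS.
Qed.

Lemma dvdp_derivn mu p n : [pchar K] =i pred0 ->
  (forall k, (k < n)%N -> p^`(k).[mu] = 0) -> ('X - mu%:P) ^+ n %| p.
Proof.
move=> charK; elim: n => [|n IHn] p0; first by rewrite expr0 dvd1p.
have /dvdpP[r Dp] : ('X - mu%:P) ^+ n %| p.
  by apply: IHn => k kn; apply/p0/ltnW.
have := p0 n (leqnn _); rewrite Dp derivn_MXsubC => /eqP.
rewrite -mulr_natr mulf_eq0 (iffLR (pcharf0P K) charK).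
rewrite (negPf (lt0n_neq0 (fact_gt0 n))) orbF -[_ == 0]/(root r mu).
by rewrite -dvdp_XsubCl exprS dvdp_mul2r ?expf_neq0 ?polyXsubC_eq0.
Qed.

Lemma prod_XsubC_dvdp s p :
  (forall mu, ('X - mu%:P) ^+ count_mem mu s %| p) ->
  \prod_(x <- s) ('X - x%:P) %| p.
Proof.
elim: s p => [|x s IHs] p dvp; first by rewrite big_nil dvd1p.
have := dvp x; rewrite /= eqxx exprS => /(dvdp_trans (dvdp_mulIl _ _)).
case/dvdpP=> e De; rewrite big_cons De mulrC dvdp_mul2r ?polyXsubC_eq0 //.
apply: IHs => mu; have := dvp mu; rewrite De /=.
case: eqVneq => [->|neq]; last first.
  by rewrite Gauss_dvdpl // coprimep_expl // coprimep_XsubC2 // subr_eq0.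
by rewrite exprS mulrC dvdp_mul2r // polyXsubC_eq0.
Qed.

Lemma principal_resolvent_exists T lambda : T != 0 -> root T lambda ->
  exists g, is_principal_resolvent T lambda g.
Proof.
move=> T0 Tl; have [m [q]] := multiplicity_XsubC T lambda.
rewrite T0 /= => ql DT.
have mE : mup lambda T = m by rewrite DT mupMr // mup_XsubCX eqxx.
have m0 : (0 < m)%N by rewrite -mE -XsubC_dvd // dvdp_XsubCl.
have co : coprimep (('X - lambda%:P) ^+ m) q.
  by rewrite coprimep_expl // coprimep_sym coprimep_XsubC.
have [[u v] /= uv] := Bezout_eq1_coprimepP _ _ co.
pose g := (v * q) %% T; exists g.
have g1 : ('X - lambda%:P) ^+ m %| g - 1.
  have -> : g - 1 = - (u * ('X - lambda%:P) ^+ m) - (v * q) %/ T * T.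
    rewrite -uv {1}(divp_eq (v * q) T) -/g.
    by rewrite addrA opprD addrCA subrr addr0 opprD.
  by rewrite DT dvdp_addl ?dvdpNr ?dvdp_mull // dvdp_mull // dvdp_mulr.
split.
- by rewrite ltn_modpN0.
- have := @derivn_root lambda (g - 1) m 0 g1 m0.
  by rewrite derivn0 !hornerE => /eqP; rewrite subr_eq0 => /eqP.
- case=> // k; rewrite mE => /andP[_ km].
  have := derivn_root g1 km; rewrite derivnB hornerD hornerN.
  by rewrite -polyC1 derivnC horner0 subr0.
- move=> mu _ mul k kn; apply: (derivn_root _ kn).
  have dT : ('X - mu%:P) ^+ mup mu T %| T by rewrite -mup_geq.
  rewrite -(dvdp_mod _ dT) dvdp_mull //.
  by rewrite -(@Gauss_dvdpl _ q (('X - lambda%:P) ^+ m)) -?DT //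
    coprimep_expl // coprimep_expr // coprimep_XsubC2 // subr_eq0 eq_sym.
Qed.

Lemma principal_resolvent_unique T lambda g1 g2 :
  [pchar K] =i pred0 -> splits T ->
  is_principal_resolvent T lambda g1 -> is_principal_resolvent T lambda g2 ->
  g1 = g2.
Proof.
move=> charK [s DT] [sz1 v1 d1 e1] [sz2 v2 d2 e2].
apply/eqP; rewrite -subr_eq0; apply: contraTT isT => nz.
have T0 : T != 0 by rewrite -size_poly_gt0 (leq_ltn_trans _ sz1).
suff /(dvdp_leq nz): T %| g1 - g2.
  rewrite leqNgt (leq_ltn_trans (size_polyD _ _)) //.
  by rewrite size_polyN gtn_max sz1.
rewrite DT; apply: prod_XsubC_dvdp => mu; rewrite -mu_prod_XsubC -DT.
apply: dvdp_derivn => // k km; rewrite derivnB hornerD hornerN.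
have rT : root T mu by rewrite -dvdp_XsubCl XsubC_dvd // (leq_ltn_trans _ km).
have [eml|neml] := eqVneq mu lambda; last by rewrite e1 // e2 // subrr.
rewrite eml in km *; case: k km => [|k] km; first by rewrite v1 v2 subrr.
by rewrite d1 // d2 // subrr.
Qed.

Lemma principal_resolvent_exists_unique T lambda :
  [pchar K] =i pred0 -> splits T -> root T lambda ->
  is_principal_resolvent T lambda (principal_resolvent T lambda) /\
  forall g, is_principal_resolvent T lambda g ->
    g = principal_resolvent T lambda.
Proof.
move=> charK splT Tl.
have T0 : T != 0 by case: splT => s ->; rewrite monic_neq0 // monic_prod_XsubC.
have res := epsilon_spec (inhabits 0) _ (principal_resolvent_exists T0 Tl).
by split=> // g gP; apply: principal_resolvent_unique gP res.
Qed.

End ResolventExistsUnique.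

(* The choice of basis is irrelevant. *)
Definition lfun_char_poly (K : fieldType) (V : vectType K) (A : 'End(V)) :
    {poly K} :=
  char_poly (mxof (vbasis {:V}) (vbasis {:V}) A).

Lemma leigenvalue_root (K : fieldType) (V : vectType K) (A : 'End(V))
    (lambda : K) :
  leigenvalue A lambda = root (lfun_char_poly A) lambda.
Proof.
have eb := vbasisP {:V}.
by rewrite -eigenvalue_root_char /leigenvalue (leigenspaceE eb) vsof_eq0.
Qed.

(* The value p(A).  The library makes 'End(V) an algebra only when V <> 0, so
   horner_alg is not available here. *)
Definition lfun_horner (K : fieldType) (V : vectType K) (A : 'End(V))
    (p : {poly K}) : 'End(V) :=
  \sum_(i < size p) p`_i *: iter i (fun f : 'End(V) => (A \o f)%VF) \1%VF.

Definition resolvent_range (K : fieldType) (V : vectType K) (A : 'End(V))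
    (lambda : K) : {vspace V} :=
  limg (lfun_horner A (principal_resolvent (lfun_char_poly A) lambda)).

Definition generalized_eigenvector (K : fieldType) (V : vectType K)
    (A : 'End(V)) (lambda : K) (v : V) : Prop :=
  exists2 m, (0 < m)%N & iter m (A - lambda *: \1)%VF v = 0.

Definition is_cycle_generated_by (K : fieldType) (V : vectType K)
    (A : 'End(V)) (lambda : K) (v : V) (c : seq V) : Prop :=
  let N := (A - lambda *: \1)%VF in
  exists p, [/\ (0 < p)%N, iter p N v = 0,
    forall q, (0 < q)%N -> iter q N v = 0 -> (p <= q)%N
    & c = traject N v p].

Definition is_cycle (K : fieldType) (V : vectType K) (A : 'End(V))
    (lambda : K) (c : seq V) : Prop :=
  exists2 v, generalized_eigenvector A lambda v
    & is_cycle_generated_by A lambda v c.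

(* Main.v *)
Require Import Defs.
From mathcomp Require Import all_boot all_algebra.

Import GRing.Theory passmx.
Local Open Scope ring_scope.

(** The statement is the Jordan normal form of one generalized eigenspace, and
    it has two independent halves.

    Linear algebra.  A subspace W on which an operator N is nilpotent has a
    basis made of N-cycles ([nilpotent_cycle_basis]).  By induction on the
    order of nilpotency, N(W) has such a basis.  Each of its cycles, generated
    by some v = N u with u in W, becomes longer by one when u is put in front
    of it.  The extended cycles are still independent, by counting dimensions:
    the span of all of them, S, is mapped by N onto N(W), whose dimension is
    the total length of the old cycles, while S meets the kernel of N at least
    in the last vectors of the cycles, of which there is one per cycle.
    Finally, W = S + (W :&: ker N), so S is completed to W by kernel vectors,
    which are cycles of length 1.

    Resolvents.  Let T be the characteristic polynomial and g the principal
    resolvent at lambda.  The operators p(A) multiply as the polynomials p do,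
    so E = g(A)(V) is stable under N = A - lambda.  Because T splits, and g
    vanishes at every other root of T to the order of that root, T divides
    (X - lambda)^m g for large m ([dvdp_XsubC_exp_resolvent]).  Then
    N^m g(A) = 0 by the Cayley-Hamilton theorem, so N is nilpotent on E. *)

(** * Cycle bases of nilpotent operators *)

Section NilpotentCycles.
Set Implicit Arguments.
Unset Strict Implicit.
Variables (K : fieldType) (V : vectType K) (N : 'End(V)).
Implicit Types (W : {vspace V}) (s t : seq (V * nat)).

(** A pair (v, p) encodes the sequence v, N v, ..., N^p v of length p + 1, so
    that no encoded sequence is empty. *)
Definition chains s : seq V := flatten [seq traject N x.1 x.2.+1 | x <- s].

Definition chain_ends s : seq V := [seq iter x.2 N x.1 | x <- s].

Lemma mem_chains s y :
  reflect (exists2 x, x \in s & exists2 i, (i <= x.2)%N & y = iter i N x.1)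
          (y \in chains s).
Proof.
apply: (iffP flatten_mapP) => [[x sx /trajectP[i ip ->]]|[x sx [i ip ->]]].
  by exists x => //; exists i.
by exists x => //; apply/trajectP; exists i.
Qed.

Lemma size_chains_cons x s :
  size (chains (x :: s)) = (x.2.+1 + size (chains s))%N.
Proof.
rewrite -[chains _]/(traject N x.1 x.2.+1 ++ chains s).
by rewrite size_cat size_traject.
Qed.

Lemma chains_free_ends s : free (chains s) -> free (chain_ends s).
Proof.
have /perm_to_subseq[r rP] : subseq (chain_ends s) (chains s).
  elim: s => // x s IHs; rewrite /chain_ends map_cons -cat1s.
  rewrite -[chains _]/(traject N x.1 x.2.+1 ++ chains s).
  by apply: cat_subseq IHs; rewrite trajectSr sub1seq mem_rcons mem_head.
by rewrite (perm_free rP); apply: catl_free.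
Qed.

(** A preimage under N taken inside W: the projection onto W, inserted both
    before N is inverted and after, replaces a choice. *)
Definition chain_lift W (v : V) : V := projv W ((N \o projv W)^-1%VF v).

Lemma chain_lift_mem W v : chain_lift W v \in W.
Proof. exact: memv_proj. Qed.

Lemma chain_liftK W v : v \in (N @: W)%VS -> N (chain_lift W v) = v.
Proof.
move=> Wv; rewrite /chain_lift -[N _]comp_lfunE limg_lfunVK //.
by rewrite limg_comp limg_proj.
Qed.

(** Independence follows from rank and nullity of N on the span of the chains
    t: the last vectors of these chains are independent in the kernel, and the
    image contains the independent vectors of s, which are one fewer per chain.
    So the dimension of the span is at least the number of vectors in t. *)
Lemma free_chains_extend s t :
    (forall x, x \in t -> iter x.2.+1 N x.1 = 0) ->
    s = [seq (N x.1, x.2.-1) | x <- t] -> (forall x, x \in t -> 0 < x.2)%N ->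
  free (chains s) -> free (chains t).
Proof.
move=> t0 -> {s} tgt0 sfree; set s := map _ t in sfree.
have Lfree : free (chain_ends t).
  have <- : chain_ends s = chain_ends t; last exact: chains_free_ends.
  rewrite /chain_ends -map_comp; apply/eq_in_map => x /tgt0 /=.
  by case: x => v [|p] //= _; rewrite -iterSr.
have sizet : size (chains t) = (size (chain_ends t) + size (chains s))%N.
  rewrite /s; elim: (t) tgt0 => // x r IHr rgt0.
  rewrite map_cons !size_chains_cons {}IHr => [|y ry]; last first.
    by rewrite rgt0 // inE ry orbT.
  by rewrite /= prednK ?rgt0 ?mem_head // !addSn addnCA.
suff: basis_of <<chains t>> (chains t) by apply: basis_free.
rewrite basisEdim subvv /= -(limg_ker_dim N) sizet leq_add //.
  rewrite -(eqnP Lfree) dimvS // subv_cap; apply/andP; split.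
    apply/span_subvP=> _ /mapP[x tx ->]; apply/memv_span/mem_chains.
    by exists x => //; exists x.2.
  apply/span_subvP=> _ /mapP[x tx ->].
  by rewrite memv_ker -iterS t0.
rewrite -(eqnP sfree) dimvS //.
apply/span_subvP=> _ /mem_chains[_ /mapP[x tx ->] /= [i ip ->]].
rewrite -iterSr; apply/memv_img/memv_span/mem_chains.
by exists x => //; exists i => //; rewrite (leq_trans ip) ?leq_pred.
Qed.

(** Induction is possible because N is nilpotent of smaller order on N(W).
    Lifting the chains of N(W) gives independent vectors of W with span S such
    that N(S) = N(W); thus S and the kernel of N in W together span W, and a
    complement of S inside their sum can be taken within the kernel, where
    every vector is a chain by itself. *)
Lemma nilpotent_cycle_basis n W :
    (N @: W <= W)%VS -> {in W, forall w, iter n N w = 0} ->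
  exists s, (forall x, x \in s -> iter x.2.+1 N x.1 = 0)
            /\ basis_of W (chains s).
Proof.
elim: n W => [|n IHn] W stW nilW.
  exists [::]; split=> //; have -> : W = 0%VS.
    by apply/eqP; rewrite -subv0; apply/subvP=> w /nilW /= ->; apply: mem0v.
  exact: nil_basis.
have [|_ /memv_imgP[w Ww ->]|s [s0 sB]] := IHn (N @: W)%VS.
- exact: limgS.
- by rewrite -iterSr nilW.
have sW x : x \in s -> x.1 \in (N @: W)%VS.
  move=> sx; apply: (basis_mem sB); apply/mem_chains.
  by exists x => //; exists 0%N.
pose t := [seq (chain_lift W x.1, x.2.+1) | x <- s].
have t0 x : x \in t -> iter x.2.+1 N x.1 = 0.
  by case/mapP=> y sy -> /=; rewrite -!iterS iterSr chain_liftK ?sW ?s0.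
have st : s = [seq (N x.1, x.2.-1) | x <- t].
  rewrite -map_comp -[LHS]map_id; apply/eq_in_map => -[v p] sx /=.
  by rewrite chain_liftK ?(sW _ sx).
have tfree : free (chains t).
  apply: free_chains_extend t0 st _ (basis_free sB).
  by move=> _ /mapP[y _ ->].
set S := <<chains t>>%VS.
have iterW i w : w \in W -> iter i N w \in W.
  move=> Ww; elim: i => //= i /(memv_img N); exact: (subvP stW).
have SW : (S <= W)%VS.
  apply/span_subvP=> _ /mem_chains[_ /mapP[x sx ->] /= [i _ ->]].
  exact/iterW/chain_lift_mem.
have imS : (N @: W <= N @: S)%VS.
  rewrite -(span_basis sB) st.
  apply/span_subvP=> _ /mem_chains[_ /mapP[x tx ->] /= [i ip ->]].
  rewrite -iterSr; apply/memv_img/memv_span/mem_chains.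
  by exists x => //; exists i => //; rewrite (leq_trans ip) ?leq_pred.
pose C := ((W :&: lker N) :\: S)%VS.
have WE : W = (S + C)%VS.
  rewrite addvC addv_diff; apply/eqP; rewrite eqEsubv subv_add capvSl SW !andbT.
  apply/subvP=> w Ww.
  have /memv_imgP[u Su Nu] := subvP imS _ (memv_img N Ww).
  rewrite -(subrK u w) memv_add // memv_cap rpredB ?(subvP SW u) //=.
  by rewrite memv_ker linearB /= Nu subrr.
exists (t ++ [seq (w, 0%N) | w <- vbasis C]); split=> [x|].
  rewrite mem_cat => /orP[/t0 //|/mapP[w /vbasis_mem Cw ->]] /=.
  have /memv_capP[_] := subvP (diffvSl _ _) _ Cw.
  by rewrite memv_ker => /eqP.
have -> : chains (t ++ [seq (w, 0%N) | w <- vbasis C]) = chains t ++ vbasis C.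
  rewrite /chains map_cat flatten_cat -map_comp; congr (_ ++ _).
  by elim: (vbasis C : seq V) => //= w r {2}<-.
rewrite WE; apply: cat_basis (vbasisP C).
  by apply/directv_addP; rewrite capvC capv_diff.
by rewrite /basis_of eqxx tfree.
Qed.

(** Once an iterate of N vanishes, so do all later ones; hence the order of a
    cycle is determined by its last vector being nonzero. *)
Lemma traject_is_cycle (lambda : K) (A : 'End(V)) v p :
    N = (A - lambda *: \1)%VF -> iter p.+1 N v = 0 -> iter p N v != 0 ->
  is_cycle A lambda (traject N v p.+1).
Proof.
move=> NE v0 vp; exists v; first by exists p.+1; rewrite -?NE.
exists p.+1; rewrite -NE; split=> // q _ q0; rewrite ltnNge.
apply: contra vp => qp; rewrite -(subnK qp) iterD q0.
by elim: (p - q)%N => //= i /eqP->; rewrite linear0.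
Qed.

End NilpotentCycles.

(** * Polynomials in an operator *)

Section OperatorPolynomials.
Set Implicit Arguments.
Unset Strict Implicit.
Variables (K : fieldType) (V : vectType K) (A : 'End(V)).
Implicit Types (p q : {poly K}) (v : V).

Lemma lfun_horner_iter n p v :
  (size p <= n)%N -> lfun_horner A p v = \sum_(i < n) p`_i *: iter i A v.
Proof.
move=> pn; have iterA i :
    iter i (fun f : 'End(V) => (A \o f)%VF) \1%VF v = iter i A v.
  by elim: i => [|i IHi] /=; rewrite ?id_lfunE // comp_lfunE IHi.
rewrite /lfun_horner sum_lfunE.
under eq_bigr => i _ do rewrite scale_lfunE iterA.
rewrite (big_ord_widen _ (fun i => p`_i *: iter i A v) pn) big_mkcond.
apply: eq_bigr => i _; case: ltnP => // pi.
by rewrite nth_default // scale0r.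
Qed.

Lemma lfun_hornerD p q v :
  lfun_horner A (p + q) v = lfun_horner A p v + lfun_horner A q v.
Proof.
pose n := maxn (size p) (size q).
rewrite !(@lfun_horner_iter n) ?leq_maxl ?leq_maxr ?size_polyD //.
by rewrite -big_split; apply: eq_bigr => i _; rewrite coefD scalerDl.
Qed.

Lemma lfun_hornerC c v : lfun_horner A c%:P v = c *: v.
Proof.
by rewrite (@lfun_horner_iter 1) ?size_polyC_leq1 // big_ord1 coefC.
Qed.

Lemma lfun_hornerZ c p v : lfun_horner A (c *: p) v = c *: lfun_horner A p v.
Proof.
rewrite !(@lfun_horner_iter (size p)) ?size_scale_leq // scaler_sumr.
by apply: eq_bigr => i _; rewrite coefZ scalerA.
Qed.

Lemma lfun_hornerMX p v : lfun_horner A (p * 'X) v = A (lfun_horner A p v).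
Proof.
rewrite (@lfun_horner_iter (size p).+1); last first.
  by rewrite (leq_trans (size_polyMleq _ _)) // size_polyX addn2.
rewrite big_ord_recl coefMX scale0r add0r (@lfun_horner_iter (size p)) //.
by rewrite linear_sum; apply: eq_bigr => i _; rewrite coefMX /= linearZ.
Qed.

Lemma lfun_hornerM p q v :
  lfun_horner A (p * q) v = lfun_horner A p (lfun_horner A q v).
Proof.
elim/poly_ind: p => [|p c IHp].
  by rewrite mul0r -polyC0 !lfun_hornerC !scale0r.
rewrite mulrDl mulrAC mul_polyC !lfun_hornerD !lfun_hornerMX lfun_hornerZ.
by rewrite IHp lfun_hornerC.
Qed.

Lemma lfun_horner_XsubC c v :
  lfun_horner A ('X - c%:P) v = (A - c *: \1)%VF v.
Proof.
rewrite -['X]mul1r -polyC1 -polyCN lfun_hornerD lfun_hornerMX !lfun_hornerC.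
by rewrite scale1r add_lfunE opp_lfunE scale_lfunE id_lfunE scaleNr.
Qed.

Lemma lfun_horner_XsubC_exp c m v :
  lfun_horner A (('X - c%:P) ^+ m) v = iter m (A - c *: \1)%VF v.
Proof.
elim: m => [|m IHm]; first by rewrite expr0 -polyC1 lfun_hornerC scale1r.
by rewrite exprS lfun_hornerM IHm lfun_horner_XsubC.
Qed.

(** Unlike [Cayley_Hamilton], this form makes sense in every dimension: square
    matrices form a nontrivial ring only in positive dimension. *)
Lemma Cayley_Hamilton_row n (M : 'M[K]_n) (x : 'rV_n) (T := char_poly M) :
  \sum_(i < size T) T`_i *: iter i (mulmxr M) x = 0.
Proof.
case: n => [|n] in M x T *; first exact: thinmx0.
have iterM i : iter i (mulmxr M) x = x *m M ^+ i.
  elim: i => [|i IHi]; first by rewrite expr0 mulmx1.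
  by rewrite iterS IHi /= exprSr mulmxA.
transitivity (x *m horner_mx M T); last by rewrite Cayley_Hamilton mulmx0.
rewrite /horner_mx /horner_morph horner_coef size_map_poly mulmx_sumr.
apply: eq_bigr => i _; rewrite iterM coef_map /= -mulmxE mulmxA.
by rewrite mul_mx_scalar scalemxAl.
Qed.

Lemma lfun_Cayley_Hamilton v : lfun_horner A (lfun_char_poly A) v = 0.
Proof.
have eb := vbasisP {:V}.
apply/eqP; rewrite -(rVof_eq0 eb) (lfun_horner_iter _ (leqnn _)).
pose x := rVof (vbasis {:V}) v; rewrite linear_sum; apply/eqP.
transitivity (\sum_(i < size (lfun_char_poly A)) (lfun_char_poly A)`_i *:
                iter i (mulmxr (mxof (vbasis {:V}) (vbasis {:V}) A)) x).
  apply: eq_bigr => i _; rewrite linearZ; congr (_ *: _).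
  by elim: (i : nat) => //= k <-; rewrite (rVof_app _ eb).
exact: Cayley_Hamilton_row.
Qed.

End OperatorPolynomials.

(** * The range of the principal resolvent *)

(** The factor (X - lambda)^m supplies the multiplicity of lambda, and g itself
    that of every other root. *)
Lemma dvdp_XsubC_exp_resolvent {K : fieldType} {T : {poly K}} {lambda g} :
    [pchar K] =i pred0 -> splits T -> is_principal_resolvent T lambda g ->
  exists m, T %| ('X - lambda%:P) ^+ m * g.
Proof.
move=> charK [r DT] [_ _ _ g0]; exists (size r); rewrite DT.
apply: prod_XsubC_dvdp => mu; have [->|neq] := eqVneq mu lambda.
  by apply/dvdp_mulr/dvdp_exp2l/count_size.
have [r_mu|/count_memPn->] := boolP (mu \in r); last by rewrite expr0 dvd1p.
apply/dvdp_mull/(dvdp_derivn charK) => k km; apply: g0 => //.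
  by rewrite DT root_prod_XsubC.
by rewrite DT mu_prod_XsubC.
Qed.

(* A basis is a duplicate-free sequence (basis_of implies free, hence uniq), so
   the cycles concatenated by flatten are pairwise disjoint. *)
Theorem theorem3p13 (K : fieldType) (V : vectType K) (A : 'End(V))
    (charK : [pchar K] =i pred0) (splitA : splits (lfun_char_poly A))
    (lambda : K) (eig : leigenvalue A lambda) :
  exists cycles : seq (seq V),
    (forall c, c \in cycles -> is_cycle A lambda c) /\
    basis_of (resolvent_range A lambda) (flatten cycles).
Proof.
rewrite leigenvalue_root in eig.
have [gP _] := principal_resolvent_exists_unique charK splitA eig.
rewrite /resolvent_range; move: (principal_resolvent _ _) gP => g gP.
have [m /dvdpP[q gT]] := dvdp_XsubC_exp_resolvent charK splitA gP.
pose N := (A - lambda *: \1)%VF; pose E := limg (lfun_horner A g).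
have stE : (N @: E <= E)%VS.
  apply/subvP=> _ /memv_imgP[_ /memv_imgP[v _ ->] ->].
  rewrite -lfun_horner_XsubC -lfun_hornerM mulrC lfun_hornerM.
  by rewrite memv_img ?memvf.
have nilE : {in E, forall w, iter m N w = 0}.
  move=> _ /memv_imgP[v _ ->]; rewrite -lfun_horner_XsubC_exp -lfun_hornerM gT.
  by rewrite lfun_hornerM lfun_Cayley_Hamilton linear0.
have [s [s0 sB]] := nilpotent_cycle_basis stE nilE.
exists [seq traject N x.1 x.2.+1 | x <- s]; split=> // _ /mapP[x sx ->].
apply: traject_is_cycle => //; first exact: s0.
apply: (basis_not0 sB); apply/mem_chains.
by exists x => //; exists x.2.
Qed.
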